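(* Let $\phi:\mathfrak h\to\mathfrak h$ be the algebra homomorphism (for concatenation) of $\mathfrak h=\mathbb C\langle x,y\rangle$ with $\phi(x)=x+y$, $\phi(y)=-y$. Then for every word $w\in\mathfrak hy$ (a word in $x,y$ ending in $y$) and every $z\in\mathbb C\setminus[1,\infty)$, $$\mathrm{Li}\left(\phi(w);\frac z{z-1}\right)=\mathrm{Li}(w;z).$$
   Context: $\mathfrak h=\mathbb C\langle x,y\rangle$ is the non-commutative polynomial algebra. For a word $w=x^{k_1-1}yx^{k_2-1}y\cdots x^{k_m-1}y$ ($k_i\ge1$), $\mathrm{Li}(w;z)=\mathrm{Li}_{k_1,\dots,k_m}(z)=\sum_{n_1>\dots>n_m>0}\frac{z^{n_1}}{n_1^{k_1}\cdots n_m^{k_m}}$ for $|z|<1$, analytically continued to $\mathbb C\setminus[1,\infty)$ (by iterated integrals of $dz/z$ and $dz/(1-z)$ starting from $0$), and $\mathrm{Li}(\bullet;z)$ is extended linearly to $\mathfrak hy$. (The homomorphism $\phi$ is the pull-back $\left(\frac z{z-1}\right)^*$ under the identification $x=d\log z$, $y=-d\log(1-z)$.) *)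

(* Defs.v *)
(* Analysis over Coquelicot's complex numbers C; algebra from MathComp and
   multinomials (monoid algebras). *)
From Stdlib Require Import Reals ClassicalEpsilon.
From Coquelicot Require Import Coquelicot.
From HB Require Import structures.
From mathcomp Require Import all_boot all_algebra.
From mathcomp Require Import boolp.
From mathcomp Require Import finmap monalg.

Set Implicit Arguments.
Unset Strict Implicit.
Unset Printing Implicit Defensive.

Import GRing.Theory.
Local Open Scope ring_scope.

(* MathComp takes over the key %R for ring_scope. *)
Delimit Scope R_scope with coqR.

(* MathComp field structure on C; every operation is Coquelicot's own. *)
HB.instance Definition _ := gen_eqMixin C.
HB.instance Definition _ := gen_choiceMixin C.
HB.instance Definition _ := GRing.isZmodule.Build C
  Cplus_assoc Cplus_comm Cplus_0_l
  (fun z : C => etrans (Cplus_comm (Copp z) z) (Cplus_opp_r z)).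

Lemma C1_neq0 : RtoC 1 != 0 :> C.
Proof. by apply/eqP; exact: C1_nz. Qed.

HB.instance Definition _ := GRing.Zmodule_isComNzRing.Build C
  Cmult_assoc Cmult_comm Cmult_1_l Cmult_plus_distr_r C1_neq0.

Lemma C_mulVf (z : C) : z != 0 -> (/ z)%C * z = 1.
Proof. by move=> /eqP z0; exact: Cinv_l. Qed.

Lemma C_inv0 : (/ (0 : C))%C = 0.
Proof. by rewrite /Cinv /= !Rmult_0_l /Rdiv Ropp_0 !Rmult_0_l. Qed.

HB.instance Definition _ := GRing.ComNzRing_isField.Build C C_mulVf C_inv0.

Variant letter := letter_x | letter_y.

Definition is_letter_y (l : letter) : bool :=
  if l is letter_y then true else false.

Lemma is_letter_yK :
  cancel is_letter_y (fun b => if b then letter_y else letter_x).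
Proof. by case. Qed.

HB.instance Definition _ := Choice.copy letter (can_type is_letter_yK).

(* Words form the free monoid {fmonom letter}, so its monoid algebra over C is
   C<x, y>, with concatenation as product. *)
Notation word := {fmonom letter}.
Notation Cxy := {malg C[word]}.

Definition gen_x : Cxy := << fmu letter_x >>.
Definition gen_y : Cxy := << fmu letter_y >>.

Definition ends_in_y (w : word) : bool := last letter_x w == letter_y.

Lemma exists_phi :
  exists phi : {lrmorphism Cxy -> Cxy},
    phi gen_x = gen_x + gen_y /\ phi gen_y = - gen_y.
Proof.
pose g (w : word) : Cxy :=
  \prod_(l <- fmonom_val w) (if l is letter_x then gen_x + gen_y else - gen_y).
have gM : monalg.isMultiplicative word Cxy g.
  split; split=> [u v|]; rewrite /g; first by rewrite fmM big_cat.
  by rewrite fm1 big_nil.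
pose G : {mmorphism word -> Cxy} := HB.pack g gM.
have malgCcomm (c : C) (p : Cxy) : GRing.comm (@malgC word C c) p.
  rewrite /GRing.comm (malgMEw (msuppU_le) (fsubset_refl _)) big_seq_fset1.
  rewrite (malgMEw (fsubset_refl _) (msuppU_le)); apply: eq_bigr => k _.
  by rewrite big_seq_fset1 mcoeffUU mulrC mulm1 mul1m.
pose f (p : Cxy) : Cxy := mmap (@malgC word C) g p.
have fA : GRing.isZmodMorphism Cxy Cxy f.
  split; exact: (@mmap_is_additive _ _ _ (@malgC word C) g).
have fM : GRing.isMonoidMorphism Cxy Cxy f.
  have [fM f1] : multiplicative f.
    apply: (@commr_mmap_is_multiplicative word C Cxy (@malgC word C) G) => p k u.
    exact: malgCcomm.
  split; split; [exact: f1 | exact: fM].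
have fZ : GRing.isScalable C Cxy Cxy *:%R f.
  split=> c p; rewrite -[RHS]mul_malgC.
  exact: (@mmapZ _ _ _ (@malgC word C) G).
pose F : {lrmorphism Cxy -> Cxy} := HB.pack f fA fM fZ.
exists F; split; rewrite /= /f (mmapU (f := @malgC word C)) /=.
  all: have -> : @malgC word C 1 = 1 by [].
  all: by rewrite mul1r /g fmU big_seq1.
Qed.

(* x^(k_1 - 1) y ... x^(k_m - 1) y |-> [:: k_1; ...; k_m]; the accumulator e
   counts the letters x since the last y. A trailing block of letters x, absent
   from words ending in y, is dropped. *)
Fixpoint exponents_from (e : nat) (s : seq letter) : seq nat :=
  match s with
  | [::] => [::]
  | letter_x :: s' => exponents_from e.+1 s'
  | letter_y :: s' => e.+1 :: exponents_from 0 s'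
  end.

Definition exponents (w : word) : seq nat := exponents_from 0 w.

(* \sum_(N > n_1 > ... > n_m > 0) 1 / (n_1 ^ k_1 ... n_m ^ k_m) *)
Fixpoint harmonic_sum (k : seq nat) (N : nat) : C :=
  if k is k1 :: k' then
    \sum_(1 <= n < N) harmonic_sum k' n / n%:R ^+ k1
  else 1.

(* The coefficient of z ^ n in the defining series of Li_k, i.e. the sum of its
   terms with n_1 = n. *)
Definition Li_coef (k : seq nat) (n : nat) : C :=
  if k is k1 :: k' then
    if n == 0%N then 0 else harmonic_sum k' n / n%:R ^+ k1
  else (n == 0%N)%:R.

(* The complement of the half-line [1, +oo). *)
Definition slit_plane (z : C) : Prop := ~ (Im z = 0 /\ 1 <= Re z)%coqR.

Definition analytic_at (f : C -> C) (z0 : C) : Prop :=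
  exists (a : nat -> C) (r : posreal),
    forall z : C, (Cmod (z - z0)%R < r)%coqR -> is_pseries a (z - z0)%R (f z).

Definition is_Li (k : seq nat) (f : C -> C) : Prop :=
  (forall z : C, (Cmod z < 1)%coqR -> is_pseries (Li_coef k) z (f z)) /\
  (forall z : C, slit_plane z -> analytic_at f z).

(* The analytic continuation exists and is unique on the (connected) slit
   plane; values off the slit plane are unspecified. *)
Definition Li_index (k : seq nat) : C -> C :=
  epsilon (inhabits (fun=> 0)) (is_Li k).

(* Linear extension in the word; meaningful for p in the span C<x, y> y of the words
   ending in y only. *)
Definition Li (p : Cxy) (z : C) : C :=
  \sum_(w <- msupp p) p@_w * Li_index (exponents w) z.

(* Main.v *)
(* Both sides are analytic in z on the slit plane, so it suffices to compare
   their Taylor expansions at 0. Under u = q z / (q z - 1), with q (1 - c) = 1,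
   the form d log z becomes du/u + du/(1 - u), and dz/(1 - z) becomes
   c du/(1 - c u) - du/(1 - u); iterated integration of these forms gives
   explicit coefficients [pull_coef c], which an Euler transform carries to those
   of Li. For c = 0, q = 1 they are the coefficients of Li (phi w), which proves
   the formula near 0.
   Li does continue to the slit plane: for Re q = 1/2 one has |c| = 1, hence
   [pull_coef c] has radius of convergence 1, and |u| < 1 is a half-plane
   Re (q z) < 1/2. These half-planes contain 0 and cover the slit plane, and the
   branches agree on overlaps by the identity theorem along rays from 0. *)
Require Import Defs.
From Stdlib Require Import Reals Lra.
From Coquelicot Require Import Coquelicot.
From mathcomp Require Import all_boot all_algebra.
From mathcomp Require Import finmap monalg.
(* ring and zify below rebind ring and field to MathComp structures. *)
Ltac real_field := field.
Ltac real_ring := ring.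
From mathcomp Require Import ring zify.

Set Implicit Arguments.
Unset Strict Implicit.
Unset Printing Implicit Defensive.

Import GRing.Theory.
Local Open Scope ring_scope.

Local Bind Scope ring_scope with C.
Local Arguments Cmod _%_R.

(* The same sum in C may be typed by different, convertible, paths in the
   algebraic hierarchy; lra only sees syntactic equality, so moduli are first
   abstracted up to conversion. *)
Ltac abstract_Cmod :=
  repeat match goal with
  | H : Rlt _ _ |- _ => revert H
  | H : Rle _ _ |- _ => revert H
  | H : @eq R _ _ |- _ => revert H
  end;
  repeat (let a := fresh "a" in
          set a := Cmod _; move: (Cmod_ge_0 _ : 0 <= a)%coqR; move: a => a).
Ltac clra := abstract_Cmod; intros; lra.
Ltac cnra := abstract_Cmod; intros; nra.

(** * Series of complex numbers *)

Lemma is_pseriesE (a : nat -> C) (z l : C) :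
  is_pseries a z l <-> is_series (fun n => a n * z ^+ n) l.
Proof.
have powE n : pow_n (z : C_AbsRing) n = z ^+ n.
  by elim: n => [|n IHn] //=; rewrite IHn exprS.
by split; apply: is_series_ext => n; rewrite powE /scal /= mulrC.
Qed.

Lemma sum_nE (u : nat -> C) n : sum_n u n = \sum_(i < n.+1) u i.
Proof.
elim: n => [|n IHn]; first by rewrite sum_O big_ord_recr big_ord0 /= add0r.
by rewrite sum_Sn IHn [RHS]big_ord_recr.
Qed.

Lemma is_seriesP (u : nat -> C) (l : C) :
  is_series u l <->
  forall e, (0 < e)%coqR -> exists N : nat, forall n, (N <= n)%N ->
    (Cmod (\sum_(i < n) u i - l)%R < e)%coqR.
Proof.
rewrite /is_series filterlim_locally_ball_norm; split=> [H e e0|H e].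
- have [N HN] := H (mkposreal e e0).
  exists N.+1 => -[|n] // /ltP le_Nn.
  by have := HN n ltac:(lia); rewrite sum_nE.
- have [N HN] := H e (cond_pos e).
  exists N => n le_Nn; rewrite sum_nE; apply: HN; lia.
Qed.

Lemma Cmod_add (z w : C) : (Cmod (z + w) <= Cmod z + Cmod w)%coqR.
Proof. exact: Cmod_triangle. Qed.

Lemma Cmod_mulr (z w : C) : Cmod (z * w) = (Cmod z * Cmod w)%coqR.
Proof. exact: Cmod_mult. Qed.

Lemma Cmod_oppr (z : C) : Cmod (- z) = Cmod z.
Proof. exact: Cmod_opp. Qed.

Lemma Cmod_subC (z w : C) : Cmod (z - w) = Cmod (w - z).
Proof. by rewrite -Cmod_oppr opprB. Qed.

Lemma Cmod_expr (z : C) n : Cmod (z ^+ n) = (Cmod z ^ n)%coqR.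
Proof.
elim: n => [|n IHn]; first by rewrite expr0 /=; exact: Cmod_1.
by rewrite exprS Cmod_mulr IHn.
Qed.

Lemma Cmod_zero : Cmod 0%R = 0%coqR.
Proof. exact: Cmod_0. Qed.

Lemma Cmod_subr_eq0 (z w : C) : Cmod (z - w) = 0%coqR -> z = w.
Proof. by move=> /Cmod_eq_0 /eqP; rewrite subr_eq0 => /eqP. Qed.

Lemma Cmod_eq_lt (z w : C) : (forall e, (0 < e)%coqR -> (Cmod (z - w) < e)%coqR) -> z = w.
Proof.
move=> H; apply: Cmod_subr_eq0.
have := Cmod_ge_0 (z - w)%R => -[pos|//].
by have := H _ pos; clra.
Qed.

Lemma is_series_uniq (u : nat -> C) (l l' : C) :
  is_series u l -> is_series u l' -> l = l'.
Proof.
move=> /is_seriesP Hl /is_seriesP Hl'; apply: Cmod_eq_lt => e e0.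
have e20 : (0 < e / 2)%coqR by clra.
have [N HN] := Hl _ e20; have [N' HN'] := Hl' _ e20.
have := Cmod_add (l - \sum_(i < maxn N N') u i) (\sum_(i < maxn N N') u i - l').
rewrite addrA subrK (Cmod_subC l (\sum_(i < _) _)).
by have := HN _ (leq_maxl N N'); have := HN' _ (leq_maxr N N'); clra.
Qed.

Lemma Cmod_sum_le n (u : nat -> C) (b : R) :
  (forall i, (i < n)%N -> (Cmod (u i) <= b)%coqR) ->
  (Cmod (\sum_(i < n) u i)%R <= INR n * b)%coqR.
Proof.
elim: n => [_|n IHn Hu]; first by rewrite big_ord0 Cmod_zero /=; clra.
rewrite big_ord_recr S_INR; apply: Rle_trans (Cmod_add _ _) _.
have := IHn (fun i lt_in => Hu i (ltnW lt_in)); have := Hu n (ltnSn n); clra.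
Qed.

Lemma ex_series_geom_bound (t : nat -> C) (A rho : R) :
  (0 <= rho < 1)%coqR -> (forall j, (Cmod (t j) <= A * rho ^ j)%coqR) ->
  exists l : C, is_series t l.
Proof.
move=> rho01 Ht; apply: (ex_series_le (V := C_CompleteNormedModule) _ _ Ht).
apply: (@ex_series_scal_l _ R_NormedModule A (fun j => pow rho j)).
by apply: ex_series_geom; rewrite Rabs_pos_eq; clra.
Qed.

(** With $B = A/(1-\rho)$ one has $A\rho^j = B\rho^j - B\rho^{j+1}$, so a block of $k$ terms from
    $N$ on telescopes to at most $B(\rho^N - \rho^{N+k})$; a large $k$ carries the bound to the
    limit. *)
Lemma geom_tail (t : nat -> C) (A rho : R) (l : C) :
  (0 <= rho < 1)%coqR -> (forall j, (Cmod (t j) <= A * rho ^ j)%coqR) ->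
  is_series t l -> forall N,
  (Cmod (\sum_(i < N) t i - l)%R <= A / (1 - rho) * rho ^ N)%coqR.
Proof.
move=> rho01 Ht /is_seriesP Hl N.
have A0 : (0 <= A)%coqR.
  by have := Ht 0%N; have := Cmod_ge_0 (t 0%N); rewrite /=; clra.
set B := (A / (1 - rho))%coqR.
have AE : A = (B * (1 - rho))%coqR by rewrite /B; real_field; clra.
have B0 : (0 <= B)%coqR by apply: Rle_mult_inv_pos; clra.
have part k : (Cmod (\sum_(i < N + k) t i - \sum_(i < N) t i)%R
               <= B * (rho ^ N - rho ^ (N + k)))%coqR.
  elim: k => [|k IHk]; first by rewrite addn0 subrr Cmod_zero; clra.
  rewrite addnS big_ord_recr /= addrAC.
  apply: Rle_trans (Cmod_add _ _) _.
  have := Ht (N + k)%N; rewrite {1}AE; cnra.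
apply: Rnot_lt_le => Hlt.
have [M HM] := Hl _ (Rlt_Rminus _ _ Hlt).
have H1 := part M; have H2 := HM (N + M)%N (leq_addl _ _).
have := Cmod_add (\sum_(i < N) t i - \sum_(i < N + M) t i) (\sum_(i < N + M) t i - l).
rewrite addrA subrK (Cmod_subC (\sum_(i < N) t i) (\sum_(i < N + M) t i)).
have : (0 <= rho ^ (N + M))%coqR by apply: pow_le; clra.
rewrite -/B in H2 *; cnra.
Qed.

Lemma is_series_mull (c : C) (u : nat -> C) (l : C) :
  is_series u l -> is_series (fun n => c * u n) (c * l).
Proof. exact: (@is_series_scal C_AbsRing C_NormedModule). Qed.

Lemma is_series_addr (u v : nat -> C) (l l' : C) :
  is_series u l -> is_series v l' -> is_series (fun n => u n + v n) (l + l').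
Proof. exact: (@is_series_plus C_AbsRing C_NormedModule). Qed.

Lemma is_series_sum (T : eqType) (s : seq T) (t : T -> nat -> C) (r : T -> C) :
  (forall i, i \in s -> is_series (t i) (r i)) ->
  is_series (fun j => \sum_(i <- s) t i j) (\sum_(i <- s) r i).
Proof.
elim: s => [_|i s IHs Ht].
  rewrite big_nil; apply/is_seriesP => e e0; exists 0%N => k _.
  by rewrite big1 ?subr0 ?Cmod_zero // => j _; rewrite big_nil.
rewrite big_cons; apply: is_series_ext (is_series_addr (Ht i (mem_head _ _))
  (IHs (fun j js => Ht j (mem_behead (s := i :: s) js)))) => j.
by rewrite big_cons.
Qed.

Lemma pow_small (A rho e : R) : (0 <= rho < 1)%coqR -> (0 < e)%coqR ->
  exists N : nat, forall n, (N <= n)%N -> (A * rho ^ n < e)%coqR.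
Proof.
move=> rho01 e0.
have rho1 : (Rabs rho < 1)%coqR by rewrite Rabs_pos_eq; clra.
have e'0 : (0 < e / (Rabs A + 1))%coqR.
  by apply: Rdiv_lt_0_compat => //; have := Rabs_pos A; clra.
have [N HN] := pow_lt_1_zero _ rho1 _ e'0.
exists N => n le_Nn; have := HN n ltac:(lia).
rewrite Rabs_pos_eq; last by apply: pow_le; clra.
move=> /(Rmult_lt_compat_l (Rabs A + 1)) => /(_ ltac:(have := Rabs_pos A; clra)).
have -> : ((Rabs A + 1) * (e / (Rabs A + 1)) = e)%coqR.
  by real_field; have := Rabs_pos A; clra.
have : (0 <= rho ^ n)%coqR by apply: pow_le; clra.
have := Rle_abs A; cnra.
Qed.

(** Interchange of summation for a double series supported on $i \le j$. The first $N$ rows together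
    form one series in $j$ whose first $N$ terms are complete columns; its tail, geometric by the
    column bound, is the difference of the two partial sums. *)
Lemma series_triangle (t : nat -> nat -> C) (r : nat -> C) (A rho : R) (l : C) :
  (0 <= rho < 1)%coqR ->
  (forall i j, (j < i)%N -> t i j = 0) ->
  (forall n j, (Cmod (\sum_(i < n) t i j)%R <= A * rho ^ j)%coqR) ->
  (forall i, is_series (t i) (r i)) ->
  is_series (fun j => \sum_(i < j.+1) t i j) l <-> is_series r l.
Proof.
move=> rho01 t0 Ht Hr.
have diff N : (Cmod (\sum_(j < N) \sum_(i < j.+1) t i j - \sum_(i < N) r i)%R
               <= A / (1 - rho) * rho ^ N)%coqR.
  have := geom_tail rho01 (Ht N) (is_series_sum (s := index_enum 'I_N) (fun i _ => Hr i)) N.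
  congr (Cmod (_ - _) <= _)%coqR; apply: eq_bigr => j _.
  rewrite -(big_mkord xpredT (t ^~ j)) -(big_mkord xpredT (t ^~ j)).
  rewrite (big_cat_nat (n := j.+1)) //= [X in _ + X]big_nat_cond.
  by rewrite [X in _ + X]big1 ?addr0 // => i /andP[/andP[/t0]].
have imp (u v : nat -> C) : (forall N, (Cmod (\sum_(j < N) u j - \sum_(j < N) v j)%R
               <= A / (1 - rho) * rho ^ N)%coqR) -> is_series u l -> is_series v l.
  move=> uv /is_seriesP Hu; apply/is_seriesP => e e0.
  have e20 : (0 < e / 2)%coqR by clra.
  have [N1 H1] := Hu _ e20.
  have [N2 H2] := pow_small (A / (1 - rho)) rho01 e20.
  exists (maxn N1 N2) => n; rewrite geq_max => /andP[/H1 {}H1 /H2 {}H2].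
  have := Cmod_add (\sum_(i < n) v i - \sum_(i < n) u i) (\sum_(i < n) u i - l).
  by rewrite addrA subrK (Cmod_subC (\sum_(i < n) v i) (\sum_(i < n) u i)); have := uv n; clra.
split; apply: imp => // N; rewrite Cmod_subC; exact: diff.
Qed.

Lemma is_series_shift (u : nat -> C) (l : C) :
  u 0%N = 0 -> is_series u l <-> is_series (fun n => u n.+1) l.
Proof.
move=> u0; split=> [Hu|Hu].
  apply: is_series_incr_1; change (is_series u (l + u 0%N)).
  by rewrite u0 addr0.
apply: is_series_decr_1; change (is_series (fun n => u n.+1) (l - u 0%N)).
by rewrite u0 subr0.
Qed.

(** * Euler transform of a power series *)

(* [lah m i] is the coefficient of [s ^ m] in [(s / (1 - s)) ^ i], that is
   ['C(m - 1, i - 1)] for positive [m] and [i]. *)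
Fixpoint lah (m i : nat) : nat :=
  match m, i with
  | 0, _ => i == 0
  | m'.+1, 0 => 0
  | m'.+1, i'.+1 => lah m' i'.+1 + lah m' i'
  end%N.

Lemma lah_small m i : (m < i)%N -> lah m i = 0%N.
Proof.
by elim: m i => [|m IHm] [|i] //= lt_mi; rewrite !IHm //; lia.
Qed.

Lemma lahS m i : lah m.+1 i.+1 = (lah m i.+1 + lah m i)%N.
Proof. by []. Qed.

Lemma Cmod_natr n : Cmod n%:R = INR n.
Proof.
have -> : n%:R = RtoC (INR n) :> C.
  elim: n => [|n IHn] //.
  by rewrite mulrS IHn S_INR addrC; apply: injective_projections; rewrite /= ?Rplus_0_l.
by rewrite Cmod_R Rabs_pos_eq //; apply: pos_INR.
Qed.

Lemma Cmod_sign i : Cmod ((-1) ^+ i) = 1%coqR.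
Proof. by rewrite Cmod_expr Cmod_oppr Cmod_1 pow1. Qed.

(** The recurrence of [lah] splits a sum at [m.+1] into two sums at [m], with weights $a_{i+1}$ and
    $a_i$, bounded by $AR \cdot R^i$ and $A R^i$; hence the factor $1 + R$. The cut-off [n] is
    arbitrary because [series_triangle] asks for all partial columns. *)
Lemma lah_weight_bound (a : nat -> C) (A R : R) m n :
  (0 <= R)%coqR -> (forall i, (Cmod (a i) <= A * R ^ i)%coqR) ->
  (Cmod (\sum_(i < n) a i * (lah m i)%:R)%R <= A * (1 + R) ^ m)%coqR.
Proof.
move=> R0; elim: m n a A => [|m IHm] [|n] a A Ha.
- by rewrite big_ord0 Cmod_zero /=; have := Ha 0%N; clra.
- rewrite big_ord_recl /= big1 ?addr0 ?mulr1; last by move=> i _; rewrite mulr0.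
  exact: Ha.
- rewrite big_ord0 Cmod_zero; apply: Rmult_le_pos.
    by have := Ha 0%N; rewrite /= => H; have := Cmod_ge_0 (a 0%N); lra.
  by apply: pow_le; lra.
rewrite big_ord_recl /= mulr0 add0r.
(* [lah m.+1 0] is 0 but [lah 0 0] is 1, so the second sum gets weight 0 at $i = 0$. *)
have -> : \sum_(i < n) a (bump 0 i) * (lah m i.+1 + lah m i)%:R =
   \sum_(i < n) a i.+1 * (lah m i)%:R
   + \sum_(i < n.+1) (if i == 0%N :> nat then 0 else a i) * (lah m i)%:R.
  rewrite big_ord_recl /= mul0r add0r -big_split /=.
  by apply: eq_bigr => i _; rewrite natrD mulrDr addrC.
apply: Rle_trans (Cmod_add _ _) _.
have := IHm n (fun i => a i.+1) (A * R)%coqR.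
move=> /(_ ltac:(move=> i; have := Ha i.+1; rewrite /=; clra)) /=.
have := IHm n.+1 (fun i => if i == 0%N then 0 else a i) A.
have Ha' i : (Cmod (if i == 0%N then 0 else a i)%R <= A * R ^ i)%coqR.
  case: eqP => [->|_ //]; have := Ha 0%N; rewrite Cmod_zero /=; clra.
by move=> /(_ Ha') /=; clra.
Qed.

(** The bound of [lah] by $2^m$ gives a sum $l$ for [i.+1]; the recurrence yields $l = s(l +
    (s/(1-s))^i)$, which is solved for $l$. *)
Lemma lah_series i (s : C) : (Cmod s < / 2)%coqR ->
  is_series (fun m => (lah m i)%:R * s ^+ m) ((s / (1 - s)) ^+ i).
Proof.
move=> s2; have s0 := Cmod_ge_0 s.
have s1 : 1 - s != 0.
  apply/eqP => /eqP; rewrite subr_eq0 => /eqP E.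
  by move: s2; rewrite -E Cmod_1; lra.
elim: i => [|i IHi].
  apply/is_seriesP => e e0; exists 1%N => -[|n] // _.
  rewrite big_ord_recl big1 /= ?mulr1 ?addr0 ?subrr ?Cmod_zero //.
  by move=> j _; rewrite mul0r.
have bound j : (Cmod ((lah j i.+1)%:R * s ^+ j) <= 1 * (2 * Cmod s) ^ j)%coqR.
  rewrite Cmod_mulr Cmod_expr Rpow_mult_distr Rmult_1_l.
  apply: Rmult_le_compat_r; first exact: pow_le.
  (* Indicator weights isolate the single entry [lah j i.+1]. *)
  have := @lah_weight_bound (fun k => (k == i.+1)%:R) 1 1 j i.+2 Rle_0_1.
  rewrite big_ord_recr big1 /= => [|k _]; last first.
    by rewrite (ltn_eqF (ltn_ord k)) mul0r.
  rewrite eqxx mul1r add0r => H; apply: Rle_trans (H _) _ => [k|].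
    by rewrite pow1 Cmod_natr; case: (k == i.+1) => /=; lra.
  by apply: Req_le; rewrite Rmult_1_l; congr (_ ^ _)%coqR; lra.
have [|l Hl] := ex_series_geom_bound _ bound; first by lra.
suff -> : (s / (1 - s)) ^+ i.+1 = l by [].
have /(is_series_shift _ (mul0r _)) H1 := Hl.
have H2 := is_series_scal s _ _ (is_series_plus _ _ _ _ Hl IHi).
have E : l = s * (l + (s / (1 - s)) ^+ i).
  apply: is_series_uniq H1 _; apply: is_series_ext H2 => m.
  rewrite lahS exprS.
  change (s * ((lah m i.+1)%:R * s ^+ m + (lah m i)%:R * s ^+ m)
          = (lah m i.+1 + lah m i)%:R * (s * s ^+ m)); ring.
apply: (mulIf s1); rewrite [RHS]mulrBr mulr1 {1}E exprS mulrAC divfK //; ring.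
Qed.

(** The coefficient of $s^m$ in $\sum_i a_i (s/(s-1))^i$, since $(s/(s-1))^i = (-1)^i
    (s/(1-s))^i$. *)
Definition mobius_coef (a : nat -> C) (m : nat) : C :=
  \sum_(i < m.+1) (-1) ^+ i * a i * (lah m i)%:R.

(** Expanding the powers of $s/(s-1)$ gives a triangular double series of ratio $|s|(1+R)$. The
    bound on $|s|$ makes this ratio less than 1 and also gives $|s| < 1/2$, as [lah_series]
    requires. *)
Lemma mobius_pseries (a : nat -> C) (A R : R) (s l : C) :
  (0 <= R)%coqR -> (forall n, (Cmod (a n) <= A * R ^ n)%coqR) ->
  (Cmod s * (2 + R) < 1)%coqR ->
  is_pseries a (s / (s - 1)) l <-> is_pseries (mobius_coef a) s l.
Proof.
move=> R0 Ha sR; have s0 := Cmod_ge_0 s.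
have s2 : (Cmod s < / 2)%coqR by nra.
pose b i : C := (-1) ^+ i * a i.
have Hb n : (Cmod (b n) <= A * R ^ n)%coqR.
  by rewrite Cmod_mulr Cmod_sign Rmult_1_l.
have A0 : (0 <= A)%coqR by have := Ha 0%N; rewrite /=; clra.
pose t i j : C := b i * ((lah j i)%:R * s ^+ j).
have := @series_triangle t (fun i => b i * (s / (1 - s)) ^+ i) A
  (Cmod s * (1 + R)) l.
move=> /(_ ltac:(nra)) [] => [i j lt_ji|n j|i|H1 H2].
- by rewrite /t lah_small // mul0r mulr0.
- have := @lah_weight_bound b A R j n R0 Hb.
  have -> : \sum_(i < n) t i j = (\sum_(i < n) b i * (lah j i)%:R) * s ^+ j.
    by rewrite mulr_suml; apply: eq_bigr => i _; exact: mulrA.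
  rewrite Cmod_mulr Cmod_expr Rpow_mult_distr => H.
  have := Rmult_le_compat_r _ _ _ (pow_le _ j s0) H; clra.
- exact: (is_series_mull (lah_series s2)).
- have E n : b n * (s / (1 - s)) ^+ n = a n * (s / (s - 1)) ^+ n.
    by rewrite /b -[s - 1]opprB invrN mulrN [in RHS]exprNn mulrCA mulrA.
  have E' n : \sum_(i < n.+1) t i n = mobius_coef a n * s ^+ n.
    by rewrite mulr_suml; apply: eq_bigr => i _; exact: mulrA.
  split=> /is_pseriesE H; apply/is_pseriesE.
    by apply: (is_series_ext _ _ _ E'); apply: H2; apply: is_series_ext H => n; rewrite E.
  by apply: (is_series_ext _ _ _ E); apply: H1; apply: is_series_ext H => n; rewrite E'.
Qed.

(** * Recentering *)

Lemma is_pseries_scale (a : nat -> C) (k z l : C) :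
  is_pseries (fun n => a n * k ^+ n) z l <-> is_pseries a (k * z) l.
Proof.
by split=> /is_pseriesE H; apply/is_pseriesE; apply: is_series_ext H => n;
  rewrite exprMn mulrA.
Qed.

Lemma series_terms_bounded (u : nat -> C) (l : C) :
  is_series u l -> exists A, forall n, (Cmod (u n) <= A)%coqR.
Proof.
move=> /is_seriesP /(_ _ Rlt_0_1) [N HN].
have [B HB] : exists B, forall n, (n < N)%N -> (Cmod (u n) <= B)%coqR.
  elim: N {HN} => [|N [B HB]]; first by exists 0%coqR.
  exists (Rmax B (Cmod (u N))) => n; rewrite ltnS leq_eqVlt => /orP[/eqP->|/HB H].
    exact: Rmax_r.
  exact: Rle_trans H (Rmax_l _ _).
exists (Rmax B 2) => n; have [/HB H|le_Nn] := ltnP n N.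
  exact: Rle_trans H (Rmax_l _ _).
apply: Rle_trans (Rmax_r _ _).
have := Cmod_add (\sum_(i < n.+1) u i - l) (l - \sum_(i < n) u i).
rewrite addrA subrK (Cmod_subC l (\sum_(i < n) u i)).
rewrite {1}big_ord_recr /= addrAC subrr add0r.
by have := HN _ le_Nn; have := HN _ (leqW le_Nn); clra.
Qed.

(** A weak Cauchy estimate: the terms at $z = r/2$ are bounded, so $R = 2/r$ will do. *)
Lemma pseries_coef_bound (a : nat -> C) (f : C -> C) (r : R) :
  (0 < r)%coqR -> (forall z, (Cmod z < r)%coqR -> is_pseries a z (f z)) ->
  exists A R, (0 < R)%coqR /\ forall n, (Cmod (a n) <= A * R ^ n)%coqR.
Proof.
move=> r0 Hf; pose z := RtoC (r / 2).
have zE : Cmod z = (r / 2)%coqR by rewrite Cmod_R Rabs_pos_eq; lra.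
have /is_pseriesE /series_terms_bounded [A HA] := Hf z ltac:(rewrite zE; lra).
exists A, (2 / r)%coqR; split=> [|n]; first by apply: Rdiv_lt_0_compat; lra.
have := HA n; rewrite Cmod_mulr Cmod_expr zE => H.
have E : ((r / 2) ^ n * (2 / r) ^ n = 1)%coqR.
  rewrite -Rpow_mult_distr; have -> : (r / 2 * (2 / r) = 1)%coqR by real_field; lra.
  exact: pow1.
have p0 : (0 <= (2 / r) ^ n)%coqR.
  by apply: pow_le; apply: Rlt_le; apply: Rdiv_lt_0_compat; lra.
have := Rmult_le_compat_r _ _ _ p0 H; rewrite Rmult_assoc E; lra.
Qed.

(** A factor $X + u$ acts on the weights: it multiplies them by $u$ or shifts them, and a shift
    costs a factor $b$. *)
Lemma binomial_weight_bound (c : nat -> C) (u : C) (B b : R) n m :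
  (0 <= b)%coqR -> (forall k, (Cmod (c k) <= B * b ^ k)%coqR) ->
  (Cmod (\sum_(k < m) c k * (('X + u%:P) ^+ n)`_k)%R <= B * (Cmod u + b) ^ n)%coqR.
Proof.
move=> b0; have u0 := Cmod_ge_0 u.
elim: n m c B => [|n IHn] [|m] c B Hc.
- by rewrite big_ord0 Cmod_zero /=; have := Hc 0%N; clra.
- rewrite big_ord_recl /= big1 ?addr0 => [|i _]; last by rewrite coef1 mulr0.
  by rewrite coef1 mulr1; exact: Hc.
- rewrite big_ord0 Cmod_zero; apply: Rmult_le_pos; last by apply: pow_le; lra.
  by have := Hc 0%N; have := Cmod_ge_0 (c 0%N); rewrite /=; clra.
have -> : \sum_(k < m.+1) c k * (('X + u%:P) ^+ n.+1)`_k =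
   u * (\sum_(k < m.+1) c k * (('X + u%:P) ^+ n)`_k)
   + \sum_(k < m) c k.+1 * (('X + u%:P) ^+ n)`_k.
  rewrite !big_ord_recl /= exprS mulrDl coefD coefXM coefCM /= add0r mulrDr mulrCA.
  rewrite -addrA; congr (_ + _); rewrite mulr_sumr -big_split /=.
  apply: eq_bigr => i _; rewrite coefD coefXM coefCM /=.
  by rewrite mulrDr addrC mulrCA.
apply: Rle_trans (Cmod_add _ _) _; rewrite Cmod_mulr.
have H1 := IHn m.+1 c B Hc.
have H2 : (Cmod (\sum_(k < m) c k.+1 * (('X + u%:P) ^+ n)`_k)%R
           <= B * b * (Cmod u + b) ^ n)%coqR.
  by apply: (IHn m (fun k => c k.+1)) => k; have := Hc k.+1; rewrite /=; clra.
have H3 := Rmult_le_compat_l _ _ _ u0 H1.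
move: H3 H2; rewrite /=; clra.
Qed.

(** $(u+v)^n$ is expanded in powers of $v$ and the sums are interchanged, with rows indexed by the
    power of $v$ and columns by $n$. The coefficients [a'] do not depend on $v$, so one series
    serves the whole disc. *)
Lemma pseries_recenter (a : nat -> C) (A R b : R) (u : C) :
  (0 <= R)%coqR -> (forall n, (Cmod (a n) <= A * R ^ n)%coqR) ->
  (0 < b)%coqR -> (R * (Cmod u + b) < 1)%coqR ->
  exists a' : nat -> C, forall v l, (Cmod v < b)%coqR ->
    is_pseries a (u + v) l -> is_pseries a' v l.
Proof.
move=> R0 Ha b0 Rub; have u0 := Cmod_ge_0 u.
pose p n := ('X + u%:P) ^+ n.
have A0 : (0 <= A)%coqR by have := Ha 0%N; have := Cmod_ge_0 (a 0%N); rewrite /=; clra.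
have bound c B n m : (forall k, (Cmod (c k) <= B * b ^ k)%coqR) ->
    (Cmod (\sum_(k < m) a n * (c k * (p n)`_k))%R
     <= A * B * (R * (Cmod u + b)) ^ n)%coqR.
  move=> Hc; rewrite -mulr_sumr Cmod_mulr Rpow_mult_distr.
  have H := @binomial_weight_bound c u B b n m ltac:(lra) Hc.
  have -> : (A * B * (R ^ n * (Cmod u + b) ^ n)
           = (A * R ^ n) * (B * (Cmod u + b) ^ n))%coqR by real_ring.
  by apply: Rmult_le_compat => //; apply: Cmod_ge_0.
have rho01 : (0 <= R * (Cmod u + b) < 1)%coqR.
  by split=> //; apply: Rmult_le_pos; lra.
have /boolp.choice [a' Ha'] : forall k, exists l : C, is_series (fun n => a n * (p n)`_k) l.
  move=> k; apply: (@ex_series_geom_bound _ (A * (/ b) ^ k) _ rho01) => n.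
  (* The indicator of $k$ picks out one coefficient and is at most $b^{-k} b^j$ at every $j$. *)
  have := @bound (fun j => (j == k)%:R) ((/ b) ^ k)%coqR n k.+1.
  rewrite big_ord_recr /= big1 => [|j _]; last first.
    by rewrite (ltn_eqF (ltn_ord j)) mul0r mulr0.
  rewrite add0r eqxx mul1r; apply=> j; rewrite Cmod_natr.
  case: eqP => [->|_] /=; last first.
    by apply: Rmult_le_pos; apply: pow_le; try lra; apply: Rlt_le; apply: Rinv_0_lt_compat.
  by rewrite -Rpow_mult_distr Rinv_l ?pow1; lra.
exists a' => v l vb /is_pseriesE Hl; apply/is_pseriesE.
pose t k n : C := a n * (v ^+ k * (p n)`_k).
apply: (proj1 (@series_triangle t _ (A * 1) _ l rho01 _ _ _)) => [k n lt_nk|m n|k|].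
- rewrite /t nth_default ?mulr0 //; apply: leq_trans lt_nk.
  by rewrite /p -[u%:P]opprK -polyCN size_exp_XsubC.
- apply: bound => k; rewrite Cmod_expr Rmult_1_l; apply: pow_incr.
  by split; [exact: Cmod_ge_0|lra].
- rewrite mulrC; apply: is_series_ext (is_series_mull (Ha' k)) => n.
  by rewrite /t mulrCA.
apply: is_series_ext Hl => n; rewrite /t -mulr_sumr; congr (_ * _).
have := @horner_coef_wide _ n.+1 (p n) v.
rewrite /p -[u%:P]opprK -polyCN size_exp_XsubC => /(_ (leqnn _)).
rewrite polyCN opprK horner_exp hornerD hornerX hornerC addrC => ->.
by apply: eq_bigr => k _; rewrite mulrC.
Qed.

(** * Analytic functions *)

Lemma pseries_analytic (a : nat -> C) (A : R) (f : C -> C) (u : C) :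
  (forall n, (Cmod (a n) <= A)%coqR) ->
  (forall z, (Cmod z < 1)%coqR -> is_pseries a z (f z)) ->
  (Cmod u < 1)%coqR -> analytic_at f u.
Proof.
move=> Ha Hf u1; pose b := ((1 - Cmod u) / 2)%coqR.
have b0 : (0 < b)%coqR by rewrite /b; lra.
have [n||a' Ha'] := @pseries_recenter a A 1 b u Rle_0_1 _ b0.
- by rewrite pow1 Rmult_1_r.
- by rewrite /b; lra.
exists a', (mkposreal b b0) => z zb; apply: (Ha' _ _ zb); rewrite addrC subrK.
apply: Hf; have := Cmod_add (z - u) u; rewrite subrK.
by move: zb; rewrite /= /b; clra.
Qed.

Lemma analytic_local (f g : C -> C) (u : C) (r : R) :
  (0 < r)%coqR -> (forall z, (Cmod (z - u) < r)%coqR -> f z = g z) ->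
  analytic_at g u -> analytic_at f u.
Proof.
move=> r0 fg [a [r' Ha]].
have m0 : (0 < Rmin r r')%coqR by apply: Rmin_pos => //; exact: cond_pos.
exists a, (mkposreal _ m0) => z /= zr.
have := Rmin_l r r'; have := Rmin_r r r' => H1 H2.
by rewrite fg; [apply: Ha|]; clra.
Qed.

Lemma analytic_cst0 (u : C) : analytic_at (fun _ => 0) u.
Proof.
exists (fun _ => 0), (mkposreal _ Rlt_0_1) => z _.
apply/is_pseriesE/is_seriesP => e e0; exists 0%N => n _.
by rewrite big1 ?subrr ?Cmod_zero // => i _; rewrite mul0r.
Qed.

Lemma analytic_addZ (k : C) (f g : C -> C) (u : C) :
  analytic_at f u -> analytic_at g u -> analytic_at (fun z => f z + k * g z) u.
Proof.
move=> [a [r Ha]] [b [r' Hb]].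
have m0 : (0 < Rmin r r')%coqR by apply: Rmin_pos; exact: cond_pos.
exists (fun n => a n + k * b n), (mkposreal _ m0) => z /= zr.
have := Rmin_l r r'; have := Rmin_r r r' => H1 H2.
have /is_pseriesE Hf := Ha z ltac:(clra); have /is_pseriesE Hg := Hb z ltac:(clra).
apply/is_pseriesE; apply: is_series_ext (is_series_addr Hf (is_series_mull Hg)) => n.
by rewrite mulrDl mulrA.
Qed.

Lemma analytic_lincomb (T : eqType) (s : seq T) (k : T -> C) (f : T -> C -> C) (u : C) :
  (forall i, i \in s -> analytic_at (f i) u) ->
  analytic_at (fun z => \sum_(i <- s) k i * f i z) u.
Proof.
elim: s => [_|i s IHs Hs].
  apply: analytic_local Rlt_0_1 _ (analytic_cst0 u) => z _; exact: big_nil.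
have Hs' : analytic_at (fun z => \sum_(j <- s) k j * f j z) u.
  by apply: IHs => j js; apply: Hs; rewrite inE js orbT.
apply: analytic_local Rlt_0_1 _ (analytic_addZ (k i) Hs' (Hs i (mem_head _ _))) => z _.
by rewrite big_cons addrC.
Qed.

(** * Composition with a Möbius map *)

Definition mobius (q z : C) : C := q * z / (q * z - 1).

(** With $d = qu - 1$ and $s = -(q/d)(z-u)$, the map changes from $u$ to $z$ by $-d^{-1} s/(s-1)$.
    The expansion of [f] at [mobius q u] therefore becomes an Euler transform in $s$, rescaled on
    both sides. *)
Lemma analytic_mobius (f : C -> C) (q u : C) :
  q * u != 1 -> analytic_at f (mobius q u) ->
  analytic_at (fun z => f (mobius q z)) u.
Proof.
move=> qu1 [a [[r r0] /= Ha]].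
pose d := q * u - 1; have d0 : d != 0 by rewrite subr_eq0.
have [|A [R [R0 HA]]] := @pseries_coef_bound a (fun v => f (mobius q u + v)) r r0.
  by move=> z zr; have := Ha (mobius q u + z); rewrite addrAC subrr add0r; apply.
pose k := - d^-1; pose p := - (q / d).
have p0 := Cmod_ge_0 p; have k0 := Cmod_ge_0 k.
(* $K|z-u| < 1$ has to imply both $|s|(2 + R|k|) < 1$ and $2|k||s| < r$; $K$ adds the two
   requirements, and the 1 keeps it positive. *)
pose K := (1 + Cmod p * (2 + R * Cmod k) + 2 * Cmod k * Cmod p / r)%coqR.
have kp0 : (0 <= Cmod k * Cmod p)%coqR by apply: Rmult_le_pos.
have kpr0 : (0 <= Cmod k * Cmod p / r)%coqR by apply: Rle_mult_inv_pos.
have Rk0 : (0 <= R * Cmod k)%coqR by apply: Rmult_le_pos; lra.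
have K1 : (0 <= Cmod p * (2 + R * Cmod k))%coqR by apply: Rmult_le_pos; lra.
have K0 : (0 < K)%coqR by rewrite /K; lra.
exists (fun n => mobius_coef (fun n => a n * k ^+ n) n * p ^+ n).
exists (mkposreal _ (Rinv_0_lt_compat _ K0)) => z /= zK.
have h0 := Cmod_ge_0 (z - u).
have zK1 : (Cmod (z - u) * K < 1)%coqR.
  by have := Rmult_lt_compat_r _ _ _ K0 zK; rewrite Rinv_l; lra.
pose s := p * (z - u).
have sE : Cmod s = (Cmod p * Cmod (z - u))%coqR by rewrite Cmod_mulr.
have sR : (Cmod s * (2 + R * Cmod k) < 1)%coqR.
  have := Rmult_le_pos _ _ h0 kpr0; rewrite sE; move: zK1; rewrite /K; cnra.
have s2 : (Cmod s < / 2)%coqR by have := Cmod_ge_0 s; nra.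
have s1 : s - 1 != 0.
  rewrite subr_eq0; apply/eqP => E; move: s2; rewrite E Cmod_1; lra.
have diff : mobius q z - mobius q u = k * (s / (s - 1)).
  have E : s - 1 = - ((q * z - 1) / d) by rewrite /s /p /d; field.
  have qz1 : q * z - 1 != 0.
    by apply: contra_neq s1 => E0; rewrite E E0 mul0r oppr0.
  rewrite E /mobius /s /p /k /d; field.
  by rewrite oppr_eq0 qz1 d0.
apply/is_pseries_scale.
apply: (proj1 (@mobius_pseries _ A (R * Cmod k) s _ Rk0 _ sR)).
  move=> n; rewrite Cmod_mulr Cmod_expr Rpow_mult_distr.
  have := Rmult_le_compat_r _ _ _ (pow_le _ n k0) (HA n); lra.
apply/is_pseries_scale; rewrite -diff; apply: Ha; rewrite diff.
rewrite !Cmod_mulr -sE.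
(* From $|s| < 1/2$, the factor $1/(s-1)$ has modulus at most 2, so the increment is at most
   $2|k||s| < r$. *)
have sm : (/ 2 <= Cmod (s - 1))%coqR.
  have := Cmod_add (1 - s) s; rewrite subrK Cmod_1 Cmod_subC; clra.
have E : (Cmod (s - 1)^-1 * Cmod (s - 1) = 1)%coqR.
  by rewrite -Cmod_mulr mulVf // Cmod_1.
have i2 : (Cmod (s - 1)^-1 <= 2)%coqR.
  by have := Cmod_ge_0 (s - 1)^-1; cnra.
apply: Rle_lt_trans (_ : _ <= Cmod k * (Cmod s * 2))%coqR _.
  apply: Rmult_le_compat_l => //; apply: Rmult_le_compat_l => //; exact: Cmod_ge_0.
have : (2 * Cmod k * Cmod p / r * Cmod (z - u) < 1)%coqR.
  have := Rmult_le_pos _ _ h0 K1; move: zK1; rewrite /K; cnra.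
move=> /(Rmult_lt_compat_r r _ _ r0).
have -> : (2 * Cmod k * Cmod p / r * Cmod (z - u) * r =
           2 * Cmod k * Cmod p * Cmod (z - u))%coqR by real_field; lra.
by rewrite sE; clra.
Qed.

(** * Isolated zeros and the identity theorem *)

Lemma is_series_drop (u : nat -> C) (l : C) n :
  (forall i, (i < n)%N -> u i = 0) -> is_series u l -> is_series (fun i => u (n + i)%N) l.
Proof.
elim: n u => [|n IHn] u u0 Hu //.
have Hu1 := proj1 (is_series_shift l (u0 0%N erefl)) Hu.
exact: (IHn (fun i => u i.+1) (fun i lt_in => u0 i.+1 lt_in) Hu1).
Qed.

(** Once the coefficients below $n$ vanish, division by $v^n$ leaves a series with sum 0 and
    constant term $a_n$, whose tail is $O(|v|)$ with $v$ as small as desired. *)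
Lemma pseries_coef_eq0 (a : nat -> C) (A R : R) :
  (0 < R)%coqR -> (forall n, (Cmod (a n) <= A * R ^ n)%coqR) ->
  (forall e, (0 < e)%coqR -> exists v : C, [/\ v != 0, (Cmod v < e)%coqR & is_pseries a v 0]) ->
  forall n, a n = 0.
Proof.
move=> R0 Ha Hv; elim/ltn_ind => n IHn.
apply: Cmod_eq_lt => e e0; rewrite subr0.
have A0 : (0 <= A)%coqR by have := Ha 0%N; have := Cmod_ge_0 (a 0%N); rewrite /=; clra.
have Rn0 : (0 < R ^ n)%coqR by exact: pow_lt.
pose B := (2 * (A * R ^ n) * R + 1)%coqR.
have B1 : (1 <= B)%coqR.
  have := Rmult_le_pos _ _ (Rmult_le_pos _ _ A0 (Rlt_le _ _ Rn0)) (Rlt_le _ _ R0).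
  by rewrite /B; lra.
(* The second bound gives $R|v| \le 1/2$, so $1/(1-R|v|) \le 2$ and the tail is at most $B|v|$; the
   first makes this less than $e$. *)
have d0 : (0 < Rmin (e / B) (/ (2 * R)))%coqR.
  apply: Rmin_pos; first by apply: Rdiv_lt_0_compat; lra.
  by apply: Rinv_0_lt_compat; lra.
have [v [v0 vd /is_pseriesE Hs]] := Hv _ d0.
have vB : (B * Cmod v < e)%coqR.
  have -> : e = (B * (e / B))%coqR by real_field; lra.
  by apply: Rmult_lt_compat_l; [|have := Rmin_l (e / B) (/ (2 * R))]; clra.
have vR : (R * Cmod v <= / 2)%coqR.
  have -> : (/ 2 = R * / (2 * R))%coqR by real_field; lra.
  by apply: Rmult_le_compat_l; [|have := Rmin_r (e / B) (/ (2 * R))]; clra.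
have cv0 := Cmod_ge_0 v.
have Rv0 : (0 <= R * Cmod v)%coqR by apply: Rmult_le_pos; lra.
have Hd : is_series (fun i => a (n + i)%N * v ^+ i) 0.
  have low i : (i < n)%N -> a i * v ^+ i = 0 by move=> /IHn ->; exact: mul0r.
  have := @is_series_mull ((v ^+ n)^-1) _ _ (is_series_drop low Hs); rewrite mulr0.
  apply: is_series_ext => i.
  by rewrite exprD mulrCA mulKf ?expf_neq0.
have bnd j : (Cmod (a (n + j)%N * v ^+ j) <= A * R ^ n * (R * Cmod v) ^ j)%coqR.
  rewrite Cmod_mulr Cmod_expr Rpow_mult_distr -Rmult_assoc (Rmult_assoc A) -pow_add.
  by apply: Rmult_le_compat_r; [exact: pow_le|exact: Ha].
have rho01 : (0 <= R * Cmod v < 1)%coqR by lra.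
have := geom_tail rho01 bnd Hd 1%N.
rewrite big_ord_recl big_ord0 addr0 subr0 expr0 mulr1 addn0 pow_1.
have C0 : (0 <= A * R ^ n)%coqR by apply: Rmult_le_pos; lra.
have : (A * R ^ n / (1 - R * Cmod v) <= A * R ^ n * 2)%coqR.
  apply: Rmult_le_compat_l => //; rewrite -[X in (_ <= X)%coqR]Rinv_inv.
  by apply: Rinv_le_contravar; lra.
move=> /(Rmult_le_compat_r _ _ _ Rv0); move: vB; rewrite /B; clra.
Qed.

(** Let $T$ be the supremum of the $t \le 1$ such that $f = g$ on $[0,t]z$. Zeros of $f - g$
    accumulate at $Tz$, so its expansion there vanishes and equality extends beyond $T$ unless $T =
    1$. *)
Lemma analytic_identity (D : C -> Prop) (f g : C -> C) (r : R) :
  (forall z t, D z -> (0 <= t <= 1)%coqR -> D (RtoC t * z)) ->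
  (forall z, D z -> analytic_at f z) -> (forall z, D z -> analytic_at g z) ->
  (0 < r)%coqR -> (forall z, (Cmod z < r)%coqR -> f z = g z) ->
  forall z, D z -> f z = g z.
Proof.
move=> star Hf Hg r0 fg z Dz.
pose d w := f w + (-1) * g w.
suff : d z = 0 by rewrite /d mulN1r => /eqP; rewrite subr_eq0 => /eqP.
have [->|z0] := eqVneq z 0.
  by rewrite /d fg ?Cmod_zero // mulN1r subrr.
have zp : (0 < Cmod z)%coqR by apply/Cmod_gt_0/eqP.
have Cmodt t w : Cmod (RtoC t * w) = (Rabs t * Cmod w)%coqR.
  by rewrite Cmod_mulr Cmod_R.
pose P t := (0 <= t <= 1)%coqR /\
  forall s, (0 <= s <= t)%coqR -> d (RtoC s * z) = 0.
have P0 t : (0 <= t <= 1)%coqR -> (t * Cmod z < r)%coqR -> P t.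
  move=> t01 tr; split=> // s s0t; rewrite /d fg ?mulN1r ?subrr //.
  rewrite Cmodt Rabs_pos_eq; last by lra.
  by apply: Rle_lt_trans tr; apply: Rmult_le_compat_r; lra.
have [T [ubT lubT]] : { T | is_lub P T }.
  apply: completeness; first by exists 1%coqR => t [] [].
  by exists 0%coqR; apply: P0; lra.
pose t0 := Rmin 1 (r / (2 * Cmod z)).
have rz0 : (0 < r / (2 * Cmod z))%coqR by apply: Rdiv_lt_0_compat; lra.
have t00 : (0 < t0)%coqR by apply: Rmin_pos; lra.
have Pt0 : P t0.
  apply: P0; first by have := Rmin_l 1 (r / (2 * Cmod z)); rewrite -/t0; lra.
  have : (t0 * Cmod z <= r / (2 * Cmod z) * Cmod z)%coqR.
    by apply: Rmult_le_compat_r; [lra|exact: Rmin_r].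
  have -> : (r / (2 * Cmod z) * Cmod z = r / 2)%coqR by real_field; lra.
  lra.
have T0 : (0 < T)%coqR by have := ubT _ Pt0; lra.
have T1 : (T <= 1)%coqR by apply: lubT => t [] []; lra.
have below s : (0 <= s < T)%coqR -> d (RtoC s * z) = 0.
  move=> s0T; have [//|/eqP ns] := eqVneq (d (RtoC s * z)) 0.
  have : (T <= s)%coqR; last by lra.
  apply: lubT => t [_ Pt]; apply: Rnot_lt_le => lt_st; apply: ns; apply: Pt; lra.
have DT : D (RtoC T * z) by apply: star => //; lra.
have [a [[r' r'0] /= Ha]] := analytic_addZ (-1) (Hf _ DT) (Hg _ DT).
have {}Ha w : (Cmod (w - RtoC T * z) < r')%coqR -> is_pseries a (w - RtoC T * z) (d w).
  exact: Ha.
have subt s : RtoC s * z - RtoC T * z = RtoC (s - T) * z.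
  by rewrite RtoC_minus -mulrBl.
have [|A [R [R0 HA]]] := @pseries_coef_bound a (fun v => d (RtoC T * z + v)) r' r'0.
  by move=> w wr; have := Ha (RtoC T * z + w); rewrite addrAC subrr add0r; apply.
have a0 : forall n, a n = 0.
  apply: (pseries_coef_eq0 R0 HA) => e e0.
  (* The accumulating zeros are $(T-m)z$, with $m$ small enough to stay on the segment, within $e$
     of $Tz$ and inside the disc of expansion. *)
  pose m := Rmin T (Rmin (e / (2 * Cmod z)) (r' / (2 * Cmod z))).
  have ez0 : (0 < e / (2 * Cmod z))%coqR by apply: Rdiv_lt_0_compat; lra.
  have r'z0 : (0 < r' / (2 * Cmod z))%coqR by apply: Rdiv_lt_0_compat; lra.
  have m0 : (0 < m)%coqR by apply: Rmin_pos => //; apply: Rmin_pos.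
  have mT : (m <= T)%coqR := Rmin_l _ _.
  have me : (m * Cmod z <= e / 2)%coqR.
    have -> : (e / 2 = e / (2 * Cmod z) * Cmod z)%coqR by real_field; lra.
    apply: Rmult_le_compat_r; first by lra.
    exact: Rle_trans (Rmin_r _ _) (Rmin_l _ _).
  have mr : (m * Cmod z <= r' / 2)%coqR.
    have -> : (r' / 2 = r' / (2 * Cmod z) * Cmod z)%coqR by real_field; lra.
    apply: Rmult_le_compat_r; first by lra.
    exact: Rle_trans (Rmin_r _ _) (Rmin_r _ _).
  have mE : Cmod (RtoC (T - m - T) * z) = (m * Cmod z)%coqR.
    by rewrite Cmodt Rabs_left; lra.
  exists (RtoC (T - m - T) * z); split.
  - apply/eqP => E; move: mE; rewrite E Cmod_zero => E'.
    by have := Rmult_lt_0_compat _ _ m0 zp; lra.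
  - by rewrite mE; lra.
  - rewrite -subt -(below (T - m)%coqR); last by lra.
    by apply: Ha; rewrite subt mE; lra.
have near w : (Cmod (w - RtoC T * z) < r')%coqR -> d w = 0.
  move=> /Ha /is_pseriesE Hw; apply: is_series_uniq Hw _.
  apply/is_seriesP => e e0; exists 0%N => n _.
  by rewrite big1 ?subrr ?Cmod_zero // => i _; rewrite a0 mul0r.
pose t1 := Rmin 1 (T + r' / (2 * Cmod z)).
have r'z0 : (0 < r' / (2 * Cmod z))%coqR by apply: Rdiv_lt_0_compat; lra.
have t1T : (T <= t1)%coqR by apply: Rmin_glb; lra.
have Pt1 : P t1.
  split=> [|s s0t]; first by have := Rmin_l 1 (T + r' / (2 * Cmod z)); rewrite -/t1; lra.
  have [/below //|Ts] : (0 <= s < T)%coqR \/ (T <= s)%coqR by lra.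
  apply: near; rewrite subt Cmodt Rabs_pos_eq; last by lra.
  have := Rmin_r 1 (T + r' / (2 * Cmod z)); rewrite -/t1 => H.
  have : ((s - T) * Cmod z <= r' / (2 * Cmod z) * Cmod z)%coqR.
    by apply: Rmult_le_compat_r; lra.
  have -> : (r' / (2 * Cmod z) * Cmod z = r' / 2)%coqR by real_field; lra.
  lra.
(* [P t1] gives $t_1 \le T$, while $T + r'/(2|z|) > T$, so the minimum is 1. *)
have t1E : t1 = 1%coqR.
  have := ubT _ Pt1; rewrite /t1 /Rmin; case: Rle_dec => //; lra.
have := proj2 Pt1 1%coqR; rewrite t1E => /(_ ltac:(lra)).
by have -> : RtoC 1 * z = z by exact: mul1r.
Qed.

(** * Coefficients of polylogarithms *)

Lemma natr_neq0 n : (n.+1)%:R != 0 :> C.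
Proof.
apply/eqP => E; have := Cmod_natr n.+1; rewrite E Cmod_zero.
by have := lt_0_INR n.+1 (PeanoNat.Nat.lt_0_succ n); lra.
Qed.

Definition binomial_transform (a : nat -> C) (m : nat) : C :=
  \sum_(i < m.+1) (-1) ^+ i * a i * 'C(m, i)%:R.

Lemma lahE m i : lah m.+1 i.+1 = 'C(m, i).
Proof.
elim: m i => [|m IHm] [|i] //.
  by rewrite lahS IHm !bin0.
by rewrite lahS !IHm binS.
Qed.

(** Pascal's rule; the shifted half of the sum picks up a sign, which produces the difference. *)
Lemma binomial_transformS (a : nat -> C) m :
  binomial_transform a m.+1 = binomial_transform (fun i => a i - a i.+1) m.
Proof.
rewrite /binomial_transform.
have -> : \sum_(i < m.+1) (-1) ^+ i * (a i - a i.+1) * 'C(m, i)%:R =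
   \sum_(i < m.+2) (-1) ^+ i * a i * 'C(m, i)%:R
   + \sum_(i < m.+1) (-1) ^+ i.+1 * a i.+1 * 'C(m, i)%:R.
  rewrite [X in _ = X + _]big_ord_recr /= bin_small // mulr0 addr0 -big_split /=.
  by apply: eq_bigr => i _; rewrite exprS; ring.
rewrite big_ord_recl [X in _ = X + _]big_ord_recl /= !bin0 -addrA; congr (_ + _).
rewrite -big_split /=; apply: eq_bigr => i _.
by rewrite /bump /= add1n binS; ring.
Qed.

Lemma mobius_coefS (a : nat -> C) m :
  mobius_coef a m.+1 = - binomial_transform (fun i => a i.+1) m.
Proof.
rewrite /mobius_coef big_ord_recl /= mulr0 add0r -sumrN.
by apply: eq_bigr => i _; rewrite -[(lah m _ + _)%N]/(lah m.+1 i.+1) lahE exprS; ring.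
Qed.

(** For $u = s/(s-1)$, taking partial sums multiplies a series by $1/(1-u) = 1-s$, which cancels the
    factor $1/(1-s)$ by which the binomial transform differs from the substitution. *)
Lemma mobius_coefE (a : nat -> C) m :
  mobius_coef a m = binomial_transform (fun n => \sum_(j < n.+1) a j) m.
Proof.
case: m => [|m].
  by rewrite /mobius_coef /binomial_transform !big_ord_recr !big_ord0 /= !add0r.
rewrite mobius_coefS binomial_transformS -sumrN; apply: eq_bigr => i _.
by rewrite [\sum_(j < i.+2) _]big_ord_recr /=; ring.
Qed.

(** Coefficient form of $s\,d/ds = (1-s)^{-1} u\,d/du$ for $u = s/(s-1)$; it comes down to the
    absorption identity for binomial coefficients. *)
Lemma mobius_coef_mulr (a : nat -> C) m :
  m%:R * mobius_coef a m = binomial_transform (fun n => n%:R * a n) m.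
Proof.
case: m => [|m].
  by rewrite mul0r /binomial_transform big_ord_recr big_ord0 /= mul0r mulr0 mul0r addr0.
rewrite mobius_coefS /binomial_transform [RHS]big_ord_recl /= mul0r mulr0 mul0r add0r.
rewrite mulrN mulr_sumr -sumrN; apply: eq_bigr => i _.
have E : m.+1%:R * 'C(m, i)%:R = i.+1%:R * 'C(m.+1, i.+1)%:R :> C.
  by rewrite -!natrM -mul_bin_diag.
transitivity (- ((-1) ^+ i * a i.+1 * (m.+1%:R * 'C(m, i)%:R))); first by ring.
by rewrite E /bump /= add1n exprS; ring.
Qed.

(** Taylor coefficients in $u$ of the iterated integral of $du/u + du/(1-u)$ for x and $c\,du/(1-cu)
    - du/(1-u)$ for y, the first letter being outermost. Division by zero gives 0, so the
    coefficient at $n = 0$ vanishes for nonempty words, as it does for an integral from 0. *)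
Fixpoint pull_coef (c : C) (s : seq letter) (n : nat) : C :=
  match s with
  | [::] => (n == 0%N)%:R
  | letter_x :: s' => (\sum_(j < n.+1) pull_coef c s' j) / n%:R
  | letter_y :: s' => (\sum_(j < n) (c ^+ (n - j) - 1) * pull_coef c s' j) / n%:R
  end.

Lemma pull_coef0 c s : s != [::] -> pull_coef c s 0 = 0.
Proof. by case: s => [|[] s] //= _; rewrite invr0 mulr0. Qed.

Lemma divr_mulnr (u : C) n : (n == 0%N -> u = 0) -> n%:R * (u / n%:R) = u.
Proof.
case: n => [->//|n _]; first by rewrite mul0r.
by rewrite mulrCA divff ?mulr1 // natr_neq0.
Qed.

Lemma Cmod_divn_le (u : C) n b : (0 <= b)%coqR ->
  (Cmod u <= INR n * b)%coqR -> (Cmod (u / n%:R) <= b)%coqR.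
Proof.
case: n => [|n] b0 Hu; first by rewrite invr0 mulr0 Cmod_zero.
have n0 : (0 < INR n.+1)%coqR by rewrite S_INR; have := pos_INR n; lra.
rewrite Cmod_mulr; apply: (Rmult_le_reg_r (INR n.+1)) => //.
have E : (Cmod n.+1%:R^-1 * INR n.+1 = 1)%coqR.
  by rewrite -Cmod_natr -Cmod_mulr mulVf ?Cmod_1 // natr_neq0.
by rewrite Rmult_assoc E; lra.
Qed.

(** Each letter costs at most a factor 2: $(n+1)/n \le 2$ for x, and $|c^k - 1| \le 2$ for y. *)
Lemma pull_coef_bound c s n : (Cmod c <= 1)%coqR ->
  (Cmod (pull_coef c s n) <= 2 ^ size s)%coqR.
Proof.
move=> c1; elim: s n => [|[] s IHs] n.
- by rewrite /= Cmod_natr; case: eqP => _ /=; lra.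
- have B0 : (0 <= 2 ^ size s)%coqR by apply: pow_le; lra.
  case: n => [|n]; first by rewrite /= invr0 mulr0 Cmod_zero /=; lra.
  apply: Cmod_divn_le; first by rewrite /=; lra.
  apply: Rle_trans (Cmod_sum_le (fun j _ => IHs j)) _.
  by rewrite (S_INR n.+1) S_INR /=; have := Rmult_le_pos _ _ (pos_INR n) B0; lra.
have B0 : (0 <= 2 ^ size s)%coqR by apply: pow_le; lra.
apply: Cmod_divn_le; first by rewrite /=; lra.
apply: (@Cmod_sum_le n (fun j => (c ^+ (n - j) - 1) * pull_coef c s j)) => j _.
rewrite Cmod_mulr.
apply: Rmult_le_compat => //; try exact: Cmod_ge_0.
apply: Rle_trans (Cmod_add _ _) _; rewrite Cmod_oppr Cmod_1 Cmod_expr.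
have [c0 H] := conj (Cmod_ge_0 c) (pow_incr _ _ (n - j) (conj (Cmod_ge_0 c) c1)).
by rewrite pow1 in H; lra.
Qed.

(** Unlike [ends_in_y], this is stable under removal of the first letter, as inductions on words
    require. *)
Definition nil_or_ends_in_y (s : seq letter) : bool :=
  (s == [::]) || (last letter_x s == letter_y).

Lemma nil_or_ends_in_y_behead l s : nil_or_ends_in_y (l :: s) -> nil_or_ends_in_y s.
Proof. by case: s. Qed.

Lemma ends_in_y_neq0 s : nil_or_ends_in_y (letter_x :: s) -> s != [::].
Proof. by case: s. Qed.

(** Leading letters x only feed the accumulator, until a y turns it into the first exponent. *)
Lemma Li_coef_x e s n : s != [::] -> nil_or_ends_in_y s ->
  Li_coef (exponents_from e.+1 s) n = Li_coef (exponents_from e s) n / n%:R.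
Proof.
elim: s e => [|[] s IHs] e //= _ Vs.
  exact: IHs (ends_in_y_neq0 Vs) (nil_or_ends_in_y_behead Vs).
case: eqP => _; first by rewrite mul0r.
by rewrite [_ ^+ e.+2]exprS invfM mulrCA mulrC.
Qed.

(** For the empty index the left side is 1, which the right side reaches through its term $j = 0$;
    hence $n > 0$. *)
Lemma harmonic_sumE k n : (0 < n)%N ->
  harmonic_sum k n = \sum_(j < n) Li_coef k j.
Proof.
case: n k => [//|n] [|k1 k] _ /=.
  by rewrite big_ord_recl big1 ?addr0.
by rewrite big_add1 /= big_mkord big_ord_recl /= add0r.
Qed.

Lemma Li_coef_y s n :
  Li_coef (exponents_from 0 (letter_y :: s)) n
  = (\sum_(j < n) Li_coef (exponents_from 0 s) j) / n%:R.
Proof.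
case: n => [|n] /=; first by rewrite invr0 mulr0.
by rewrite expr1 harmonic_sumE.
Qed.

Lemma Li_coef_bound s n : nil_or_ends_in_y s ->
  (Cmod (Li_coef (exponents_from 0 s) n) <= 1)%coqR.
Proof.
elim: s n => [|[] s IHs] n Vs.
- by rewrite /= Cmod_natr; case: eqP => _ /=; lra.
- have Vs' := nil_or_ends_in_y_behead Vs.
  rewrite Li_coef_x ?(ends_in_y_neq0 Vs) //.
  case: n => [|n]; first by rewrite invr0 mulr0 Cmod_zero; lra.
  apply: Cmod_divn_le; first by lra.
  by have := IHs n.+1 Vs'; rewrite S_INR; have := pos_INR n; lra.
rewrite Li_coef_y; apply: Cmod_divn_le; first by lra.
apply: (@Cmod_sum_le n (Li_coef (exponents_from 0 s))) => j _.
exact/IHs/nil_or_ends_in_y_behead/Vs.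
Qed.

(** The substitution $u = qz/(qz-1)$ on coefficients, by induction on the word. For x,
    [mobius_coef_mulr] and [mobius_coefE] undo the division by $n$ and the partial sums; for y, a
    first-order recurrence telescopes to partial sums of [Li_coef]. *)
Lemma pull_coefP (c q : C) s m : q * (1 - c) = 1 -> nil_or_ends_in_y s ->
  mobius_coef (pull_coef c s) m * q ^+ m = Li_coef (exponents_from 0 s) m.
Proof.
move=> qc; elim: s m => [|[] s IHs] m Vs.
- rewrite mobius_coefE; case: m => [|m].
    by rewrite /binomial_transform !big_ord1 /= bin0 !(expr0, mulr1, mul1r).
  rewrite binomial_transformS /binomial_transform big1 ?mul0r // => i _.
  by rewrite [X in _ - X]big_ord_recr /= addr0 subrr mulr0 mul0r.
- have Vs' := nil_or_ends_in_y_behead Vs; have s0 := ends_in_y_neq0 Vs.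
  rewrite Li_coef_x //; case: m => [|m].
    rewrite invr0 mulr0 /mobius_coef big_ord_recr big_ord0 /= invr0.
    by rewrite !(mulr0, mul0r, addr0).
  rewrite -(IHs _ Vs') mulrAC; congr (_ * _).
  apply: (mulIf (natr_neq0 m)); rewrite divfK ?natr_neq0 // mulrC.
  rewrite mobius_coef_mulr mobius_coefE; apply: eq_bigr => i _.
  rewrite [X in _ * X * _ = _](_ : _ = \sum_(j < i.+1) pull_coef c s j) //=.
  apply: divr_mulnr => /eqP ->.
  by rewrite big_ord1 pull_coef0.
have Vs' := nil_or_ends_in_y_behead Vs; rewrite Li_coef_y.
pose a := pull_coef c s; pose w n := \sum_(j < n) (c ^+ (n - j) - 1) * a j.
have aE n : n%:R * pull_coef c (letter_y :: s) n = w n.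
  by apply: divr_mulnr => /eqP ->; rewrite /w big_ord0.
(* This combination cancels the powers of $c$ and leaves partial sums of [a], whose binomial
   transform is [mobius_coef a]. *)
have step n : c * w n - w n.+1 = (1 - c) * \sum_(j < n.+1) a j.
  rewrite /w big_ord_recr /= subSnn expr1 [in RHS]big_ord_recr /= mulrDr.
  rewrite mulr_sumr opprD addrA -sumrB mulr_sumr; congr (_ + _); last by ring.
  apply: eq_bigr => j _; rewrite subSn ?exprS; first by ring.
  exact: ltnW.
have wS n : q * binomial_transform w n.+1 - binomial_transform w n
    = mobius_coef a n.
  have E : c * binomial_transform w n - binomial_transform (fun i => w i.+1) n
           = (1 - c) * mobius_coef a n.
    rewrite mobius_coefE /binomial_transform !mulr_sumr -sumrB.
    apply: eq_bigr => i _.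
    transitivity ((-1) ^+ i * (c * w i - w i.+1) * 'C(n, i)%:R); first by ring.
    by rewrite step; ring.
  rewrite binomial_transformS.
  have -> : binomial_transform (fun i => w i - w i.+1) n =
     binomial_transform w n - binomial_transform (fun i => w i.+1) n.
    by rewrite -sumrB; apply: eq_bigr => i _; ring.
  have qE : q * ((1 - c) * mobius_coef a n) = mobius_coef a n by rewrite mulrA qc mul1r.
  rewrite -qE -E -[X in _ - X]mul1r -qc; ring.
case: m => [|m].
  by rewrite invr0 mulr0 /mobius_coef big_ord_recr big_ord0 /= invr0 !(mulr0, mul0r, addr0).
apply: (mulIf (natr_neq0 m)); rewrite divfK ?natr_neq0 // mulrC mulrA mobius_coef_mulr.
have -> : binomial_transform (fun n => n%:R * pull_coef c (letter_y :: s) n) m.+1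
    = binomial_transform w m.+1 by apply: eq_bigr => i _; rewrite aE.
have w0 : binomial_transform w 0 = 0.
  by rewrite /binomial_transform big_ord1 /w big_ord0 mulr0 mul0r.
(* Multiplied by $q^n$, [wS] telescopes. *)
elim: m => [|m IHm].
  by rewrite big_ord1 -(IHs _ Vs') -/a -wS w0; ring.
by rewrite [RHS]big_ord_recr -IHm -(IHs _ Vs') -/a -wS exprS /=; ring.
Qed.

(** * Analytic continuation *)

Lemma bounded_pseries (a : nat -> C) (A : R) : (forall n, (Cmod (a n) <= A)%coqR) ->
  exists g : C -> C, forall z, (Cmod z < 1)%coqR -> is_pseries a z (g z).
Proof.
move=> Ha.
have ex z : exists l : C, (Cmod z < 1)%coqR -> is_pseries a z l.
  have [z1|z1] := Rlt_dec (Cmod z) 1; last by exists 0.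
  have [//|n|l Hl] := @ex_series_geom_bound (fun n => a n * z ^+ n) A (Cmod z).
  - by split=> //; exact: Cmod_ge_0.
  - rewrite Cmod_mulr Cmod_expr; apply: Rmult_le_compat_r (Ha n).
    by apply: pow_le; exact: Cmod_ge_0.
  by exists l => _; apply/is_pseriesE.
by have [g Hg] := boolp.choice ex; exists g.
Qed.

Lemma pseries_uniq (a : nat -> C) (z l l' : C) :
  is_pseries a z l -> is_pseries a z l' -> l = l'.
Proof. by move=> /is_pseriesE H /is_pseriesE; exact: is_series_uniq. Qed.

Lemma Cmod_ratio_lt1 (s : C) : (Cmod s < Cmod (s - 1))%coqR -> (Cmod (s / (s - 1)) < 1)%coqR.
Proof.
move=> H; have s0 := Cmod_ge_0 s.
have s1 : s - 1 != 0 by apply/eqP => E; move: H; rewrite E Cmod_zero; lra.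
apply: (Rmult_lt_reg_r (Cmod (s - 1))); first by clra.
by rewrite -Cmod_mulr divfK //; clra.
Qed.

Lemma Cmod_half_plane (s : C) : (Re s < / 2)%coqR -> (Cmod s < Cmod (s - 1))%coqR.
Proof.
case: s => x y /= xh; apply: sqrt_lt_1_alt => /=; split; first by nra.
by rewrite Ropp_0 Rplus_0_r; nra.
Qed.

(** The 3 is $2 + R$ with $R = 1$, the [pull_coef] being bounded. *)
Lemma pull_near0 (c q : C) (s : seq letter) (z l : C) :
  q * (1 - c) = 1 -> nil_or_ends_in_y s -> (Cmod c <= 1)%coqR -> (Cmod (q * z) * 3 < 1)%coqR ->
  is_pseries (pull_coef c s) (mobius q z) l <->
  is_pseries (Li_coef (exponents_from 0 s)) z l.
Proof.
move=> qc Vs c1 qz.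
have := @mobius_pseries (pull_coef c s) (2 ^ size s) 1 (q * z) l Rle_0_1.
move=> /(_ ltac:(move=> n; rewrite pow1 Rmult_1_r; exact: pull_coef_bound) ltac:(clra)) H.
have H' : is_pseries (Li_coef (exponents_from 0 s)) z l <->
    is_pseries (mobius_coef (pull_coef c s)) (q * z) l.
  split=> [Hs|/is_pseries_scale Hs]; [apply/is_pseries_scale|];
    apply: is_pseries_ext Hs => n; by rewrite (pull_coefP n qc Vs).
by split=> [/H/H'|/H'/H].
Qed.

Lemma Cmod_mobius_lt1 (q z : C) : (Cmod (q * z) * 3 < 1)%coqR -> (Cmod (mobius q z) < 1)%coqR.
Proof.
move=> qz; apply: Cmod_ratio_lt1.
have := Cmod_add (1 - q * z) (q * z); rewrite subrK Cmod_1 Cmod_subC.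
have := Cmod_ge_0 (q * z); clra.
Qed.

(** * Half-planes covering the slit plane *)

Definition slope (t : R) : C := (/ 2, t)%coqR.
(** The point $q$ = [slope t] is equidistant from 0 and 1, so $c = 1 - 1/q$ has modulus 1. The
    inequality puts $qz$ closer to 0 than to 1, so [mobius q z] lies in the unit disc. *)
Definition half_plane (t : R) (z : C) : Prop := (Re (slope t * z) < / 2)%coqR.

Lemma Re_slope t (z : C) : Re (slope t * z) = (Re z / 2 - t * Im z)%coqR.
Proof. by case: z => x y; rewrite /Re /Im /slope /=; lra. Qed.

Lemma half_plane_star t z u : half_plane t z -> (0 <= u <= 1)%coqR -> half_plane t (RtoC u * z).
Proof.
rewrite /half_plane !Re_slope; case: z => x y; rewrite /Re /Im /= => H u01.
rewrite !Rmult_0_l Rminus_0_r Rplus_0_r.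
have -> : (u * x / 2 - t * (u * y) = u * (x / 2 - t * y))%coqR by real_field.
by have [u1|->] := Rle_lt_or_eq_dec _ _ u01.2; nra.
Qed.

Lemma half_plane_open t z : half_plane t z ->
  exists r, (0 < r)%coqR /\ forall w, (Cmod (w - z) < r)%coqR -> half_plane t w.
Proof.
rewrite /half_plane => Hz; have s0 := Cmod_ge_0 (slope t).
exists ((/ 2 - Re (slope t * z)) / (Cmod (slope t) + 1))%coqR; split=> [|w Hw].
  by apply: Rdiv_lt_0_compat; lra.
have := Rmult_lt_compat_l (Cmod (slope t) + 1) _ _ ltac:(lra) Hw.
have -> : ((Cmod (slope t) + 1) * ((/ 2 - Re (slope t * z)) / (Cmod (slope t) + 1))
   = / 2 - Re (slope t * z))%coqR by real_field; lra.
have := Rle_trans _ _ _ (Rle_abs _) (re_le_Cmod (slope t * (w - z))).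
have -> : Re (slope t * (w - z)) = (Re (slope t * w) - Re (slope t * z))%coqR.
  by rewrite mulrBr.
have := Cmod_ge_0 (w - z); rewrite Cmod_mulr; clra.
Qed.

Lemma half_plane_slit t z : half_plane t z -> slit_plane z.
Proof. by rewrite /half_plane Re_slope => H [z0 z1]; move: H; rewrite z0; lra. Qed.

(** For non-real $z$ this slope makes the real part of [slope t * z] zero; for real $z$ the slope is
    multiplied by [Im z], which is 0. *)
Lemma slit_half_plane z : slit_plane z -> half_plane (Re z / (2 * Im z)) z.
Proof.
rewrite /half_plane Re_slope => Hz.
have [z0|z0] := Req_dec (Im z) 0.
  by rewrite z0 Rmult_0_r; have := fun H => Hz (conj z0 H); lra.
have -> : (Re z / 2 - Re z / (2 * Im z) * Im z = 0)%coqR by real_field; lra.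
lra.
Qed.

Lemma disc_slit z : (Cmod z < 1)%coqR -> slit_plane z.
Proof.
move=> z1 [_ H]; have := Rle_trans _ _ _ (Rle_abs _) (re_le_Cmod z); lra.
Qed.

(** The branch is the sum of the [pull_coef] series at [mobius q z]; near 0, [pull_near0] identifies
    it with the defining series. *)
Lemma half_plane_branch (s : seq letter) t : nil_or_ends_in_y s ->
  exists f : C -> C, (forall z, half_plane t z -> analytic_at f z) /\
  exists r, (0 < r)%coqR /\
    forall z, (Cmod z < r)%coqR -> is_pseries (Li_coef (exponents_from 0 s)) z (f z).
Proof.
move=> Vs; pose q := slope t; pose c := 1 - q^-1.
have q0 : q != 0.
  by apply/eqP => /(congr1 Re) /=; lra.
have qp : (0 < Cmod q)%coqR by apply/Cmod_gt_0/eqP.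
have qc : q * (1 - c) = 1 by rewrite /c opprB addrC subrK divff.
have c1 : (Cmod c <= 1)%coqR.
  (* $|c||q| = |q-1| = |q|$, because $q$ has real part $1/2$. *)
  have : (Cmod c * Cmod q = Cmod q)%coqR.
    rewrite -Cmod_mulr /c mulrBl mulVf // mul1r /Cmod /=; congr sqrt.
    by rewrite Ropp_0 Rplus_0_r; lra.
  move: qp; cnra.
have [g Hg] := bounded_pseries (fun n => pull_coef_bound s n c1).
exists (fun z => g (mobius q z)); split=> [z Hz|].
  have Hm := Cmod_half_plane Hz.
  apply: analytic_mobius; last first.
    by apply: pseries_analytic (fun n => pull_coef_bound s n c1) Hg (Cmod_ratio_lt1 Hm).
  apply/eqP => E; move: Hm; rewrite -/q E subrr Cmod_zero.
  by have := Cmod_ge_0 1; lra.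
exists (/ (3 * Cmod q))%coqR; split=> [|z Hz]; first by apply: Rinv_0_lt_compat; lra.
have qz : (Cmod (q * z) * 3 < 1)%coqR.
  have := Rmult_lt_compat_l (3 * Cmod q) _ _ ltac:(lra) Hz.
  by rewrite Rinv_r; [rewrite Cmod_mulr; clra|lra].
apply: (proj1 (pull_near0 _ qc Vs c1 qz)); exact: Hg (Cmod_mobius_lt1 qz).
Qed.

(** Each $z$ uses the branch of a half-plane chosen from $z$ itself. Two branches have the same
    series near 0, so they agree on the intersection of their half-planes, which is star-shaped
    about 0. *)
Lemma is_Li_exists (s : seq letter) : nil_or_ends_in_y s ->
  exists f, is_Li (exponents_from 0 s) f.
Proof.
move=> Vs; set k := exponents_from 0 s.
have [L HL] := bounded_pseries (fun n => Li_coef_bound n Vs).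
have [F HF] := boolp.choice (fun t => half_plane_branch t Vs).
pose slope_at z := (Re z / (2 * Im z))%coqR.
have agree (D : C -> Prop) f g z :
  (forall z t, D z -> (0 <= t <= 1)%coqR -> D (RtoC t * z)) ->
  (forall z, D z -> analytic_at f z) -> (forall z, D z -> analytic_at g z) ->
  (exists r, (0 < r)%coqR /\ forall z, (Cmod z < r)%coqR -> is_pseries (Li_coef k) z (f z)) ->
  (exists r, (0 < r)%coqR /\ forall z, (Cmod z < r)%coqR -> is_pseries (Li_coef k) z (g z)) ->
  D z -> f z = g z.
  move=> star Df Dg [r [r0 Hf]] [r' [r'0 Hg]].
  apply: (analytic_identity star Df Dg (Rmin_pos _ _ r0 r'0)) => w wr.
  have := Rmin_l r r'; have := Rmin_r r r' => H1 H2.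
  by apply: pseries_uniq (Hf w _) (Hg w _); clra.
exists (fun z => F (slope_at z) z); split=> z Hz.
  suff -> : F (slope_at z) z = L z by exact: HL.
  apply: (agree (fun w => half_plane (slope_at z) w /\ (Cmod w < 1)%coqR)).
  - move=> w t [Hw w1] t01; split; first exact: half_plane_star.
    by rewrite Cmod_mulr Cmod_R Rabs_pos_eq; have := Cmod_ge_0 w; nra.
  - by move=> w [Hw _]; exact: (HF _).1.
  - by move=> w [_ w1]; exact: pseries_analytic (fun n => Li_coef_bound n Vs) HL w1.
  - exact: (HF _).2.
  - by exists 1%coqR; split=> //; exact: Rlt_0_1.
  - by split=> //; apply/slit_half_plane/disc_slit.
have Hz' := slit_half_plane Hz; have [r [r0 Hr]] := half_plane_open Hz'.
(* A neighbour [w] takes the branch of its own slope, which is compared with the branch at [z]. *)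
apply: analytic_local r0 _ ((HF (slope_at z)).1 z Hz') => w /Hr Hw.
apply: (agree (fun v => half_plane (slope_at w) v /\ half_plane (slope_at z) v)).
- by move=> v t [H1 H2] t01; split; exact: half_plane_star.
- by move=> v [Hv _]; exact: (HF _).1.
- by move=> v [_ Hv]; exact: (HF _).1.
- exact: (HF _).2.
- exact: (HF _).2.
- by split=> //; apply/slit_half_plane/half_plane_slit/Hw.
Qed.

Lemma Li_indexP (s : seq letter) : nil_or_ends_in_y s ->
  is_Li (exponents_from 0 s) (Li_index (exponents_from 0 s)).
Proof. by move=> /is_Li_exists; exact: ClassicalEpsilon.epsilon_spec. Qed.

(** * The substitution phi *)

(** [mmap idfun F p] is $\sum_v p_v F(v)$, the linear extension of [F] to the monoid algebra. *)
Lemma mmap_genM (F : word -> C) (k : word) (p : Cxy) :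
  mmap idfun F (<< k >> * p) = mmap idfun (fun v => F (mmul k v)) p.
Proof.
rewrite malgM_def fgmulUg raddf_sum; apply: eq_bigr => v _.
by rewrite mul1r /= mmapU.
Qed.

Lemma msupp_genM (k v : word) (p : Cxy) : v \in msupp (<< k >> * p) ->
  exists2 u, u \in msupp p & v = mmul k u.
Proof.
move=> /msuppM_le [k1 [u [k1k up ->]]]; exists u => //.
by move: k1k; rewrite msuppU1 inE => /eqP ->.
Qed.

Lemma mmap_divr_sum (F : word -> nat -> C) m n (p : Cxy) :
  mmap idfun (fun v => (\sum_(j < m) F v j) / n%:R) p
  = (\sum_(j < m) mmap idfun (F ^~ j) p) / n%:R.
Proof.
rewrite exchange_big /= mulr_suml; apply: eq_bigr => v _.
by rewrite mulrA mulr_sumr.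
Qed.

Lemma gen_cons l (s : seq letter) :
  << FMonom (l :: s) >>
  = (if l is letter_x then gen_x else gen_y) * << FMonom s >> :> Cxy.
Proof.
have -> : (if l is letter_x then gen_x else gen_y) = << fmu l >> by case: l.
rewrite malgM_def fgmulUU mulr1; congr << _ >>.
by apply/eqP; rewrite fmP fmM fmU.
Qed.

Definition Li_word_coef n (v : word) : C := Li_coef (exponents v) n.

Lemma exponents_genM l (v : word) : exponents (mmul (fmu l) v) = exponents_from 0 (l :: v).
Proof. by rewrite /exponents fmM fmU. Qed.

Lemma phiM (phi : {lrmorphism Cxy -> Cxy}) (p p' : Cxy) : phi (p * p') = phi p * phi p'.
Proof. exact: rmorphM. Qed.

Lemma phi_cons_x (phi : {lrmorphism Cxy -> Cxy}) s :
  phi gen_x = gen_x + gen_y ->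
  phi << FMonom (letter_x :: s) >> =
  gen_x * phi << FMonom s >> + gen_y * phi << FMonom s >>.
Proof. by move=> phi_x; rewrite gen_cons phiM phi_x mulrDl. Qed.

Lemma phi_cons_y (phi : {lrmorphism Cxy -> Cxy}) s :
  phi gen_y = - gen_y ->
  phi << FMonom (letter_y :: s) >> = - (gen_y * phi << FMonom s >>).
Proof. by move=> phi_y; rewrite gen_cons phiM phi_y mulNr. Qed.

Lemma phi_nil (phi : {lrmorphism Cxy -> Cxy}) : phi << FMonom [::] >> = << FMonom [::] >>.
Proof.
have -> : << FMonom [::] >> = 1 :> Cxy.
  by congr << _ >>; apply/eqP; rewrite fmP fm1.
exact: rmorph1.
Qed.

(** The final y is sent to $-y$, so last letters remain y. Nonemptiness is carried along because x
    in front of the empty word would give a word ending in x. *)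
Lemma phi_supp (phi : {lrmorphism Cxy -> Cxy}) s v :
  phi gen_x = gen_x + gen_y -> phi gen_y = - gen_y ->
  nil_or_ends_in_y s -> v \in msupp (phi << FMonom s >>) ->
  nil_or_ends_in_y v /\ (s != [::] -> v != [::] :> seq letter).
Proof.
move=> phi_x phi_y; elim: s v => [|l s IHs] v Vs.
  by rewrite phi_nil msuppU1 inE => /eqP ->.
have genP k : k = letter_y \/ s != [::] ->
    v \in msupp (<< fmu k >> * phi << FMonom s >>) ->
    nil_or_ends_in_y v /\ (l :: s != [::] -> v != [::] :> seq letter).
  move=> ks /msupp_genM [u /(IHs _ (nil_or_ends_in_y_behead Vs)) [Vu u0] ->].
  rewrite fmM fmU; split=> //.
  by case: ks => [->|/u0]; move: Vu; case: (fmonom_val u) => [|a t].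
case: l Vs genP => Vs genP.
  rewrite phi_cons_x // => /(fsubsetP (msuppD_le _ _)); rewrite inE.
  move=> /orP[] /genP; apply; [right|by left].
  exact: ends_in_y_neq0 Vs.
by rewrite phi_cons_y // msuppN => /genP; apply; left.
Qed.

(** At $c = 0$ the recursion of [pull_coef] mirrors [phi]: for x, the term $j = n$ of the sum comes
    from x and the terms $j < n$ from y; for y, the factor $0^{n-j} - 1 = -1$ is the sign in
    $\phi(y) = -y$. *)
Lemma phi_Li_coef (phi : {lrmorphism Cxy -> Cxy}) s n :
  phi gen_x = gen_x + gen_y -> phi gen_y = - gen_y ->
  nil_or_ends_in_y s ->
  mmap idfun (Li_word_coef n) (phi << FMonom s >>) = pull_coef 0 s n.
Proof.
move=> phi_x phi_y; elim: s n => [|l s IHs] n Vs; first by rewrite phi_nil mmapU mul1r.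
have Vs' := nil_or_ends_in_y_behead Vs.
have Hy : mmap idfun (Li_word_coef n) (gen_y * phi << FMonom s >>) =
    (\sum_(j < n) pull_coef 0 s j) / n%:R.
  rewrite mmap_genM; under eq_bigr => j _ do rewrite -(IHs _ Vs').
  rewrite -(mmap_divr_sum (fun v j => Li_word_coef j v)); apply: eq_bigr => v _.
  by rewrite /Li_word_coef exponents_genM Li_coef_y.
case: l Vs => Vs.
  rewrite phi_cons_x // mmapD [X in _ + X]Hy /= big_ord_recr mulrDl addrC.
  congr (_ + _).
  rewrite -(IHs _ Vs') mmap_genM mulr_suml; apply: eq_big_seq => v.
  move=> /(phi_supp phi_x phi_y Vs') [Vv /(_ (ends_in_y_neq0 Vs)) v0].
  by rewrite /Li_word_coef exponents_genM /= Li_coef_x // mulrA.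
rewrite phi_cons_y // mmapN Hy /= -mulNr; congr (_ / _); rewrite -sumrN.
apply: eq_bigr => j _; rewrite expr0n subn_eq0 leqNgt ltn_ord /=.
by rewrite add0r mulN1r.
Qed.

(** If $z/(z-1)$ were a real $r \ge 1$, then $(r-1)z = r$, so $r \ne 1$ and $z = r/(r-1)$ would be
    real and greater than 1. *)
Lemma slit_mobius1 z : slit_plane z -> slit_plane (mobius 1 z).
Proof.
move=> Hz [u0 u1].
have z1 : z - 1 != 0.
  rewrite subr_eq0; apply/eqP => E; apply: Hz; rewrite E /=; lra.
pose r := Re (mobius 1 z).
have uE : mobius 1 z = RtoC r by apply: injective_projections.
have E : RtoC r * (z - 1) = z by rewrite -uE /mobius mul1r divfK.
have := congr1 Re E; have := congr1 Im E.
move: Hz u1; rewrite -/r /slit_plane; case: z {u0 z1 uE E} r => x y r /= Hz r1.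
rewrite !Rmult_0_l => Ey Ex; apply: Hz.
have Ey' : ((r - 1) * y = 0)%coqR by lra.
have Ex' : ((r - 1) * x = r)%coqR by lra.
have r1' : (r - 1 <> 0)%coqR by move=> E; rewrite E in Ex'; lra.
split; first by case: (Rmult_integral _ _ Ey').
by nra.
Qed.

Theorem proposition3 (phi : {lrmorphism Cxy -> Cxy})
    (phi_x : phi gen_x = gen_x + gen_y) (phi_y : phi gen_y = - gen_y)
    (w : word) (z : C) :
  ends_in_y w -> slit_plane z ->
  Li (phi << w >>) (z / (z - 1))%R = Li << w >> z.
Proof.
move=> wy Hz; have Vw : nil_or_ends_in_y w by rewrite /nil_or_ends_in_y -/(ends_in_y w) wy orbT.
have supp v : v \in msupp (phi << w >>) -> nil_or_ends_in_y v.
  by rewrite -[w]fmK => /(phi_supp phi_x phi_y Vw) [].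
have rhsE : Li << w >> z = Li_index (exponents w) z.
  by rewrite /Li msuppU1 big_seq_fset1 mcoeffUU mul1r.
pose G u := \sum_(v <- msupp (phi << w >>))
  (phi << w >>)@_v * Li_index (exponents v) (mobius 1 u).
have -> : Li (phi << w >>) (z / (z - 1)) = G z by rewrite /G /mobius mul1r.
rewrite rhsE.
(* The radius $1/3$ is the condition of [pull_near0] for $q = 1$, $c = 0$. *)
apply: (@analytic_identity slit_plane _ _ (/ 3)) (Hz); last 1 first.
- move=> u Hu; have qu : (Cmod (1 * u) * 3 < 1)%coqR by rewrite mul1r; lra.
  have u1 := Cmod_mobius_lt1 qu.
  apply: (@pseries_uniq (Li_coef (exponents w)) u); last by apply: (Li_indexP Vw).1; clra.
  have qc : 1 * (1 - 0) = 1 :> C by rewrite subr0 mulr1.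
  have c1 : (Cmod 0 <= 1)%coqR by rewrite Cmod_zero; lra.
  apply: (proj1 (pull_near0 _ qc Vw c1 qu)); apply/is_pseriesE.
  pose a v n := (phi << w >>)@_v * (Li_coef (exponents v) n * mobius 1 u ^+ n).
  have Ha v : v \in msupp (phi << w >>) ->
      is_series (a v) ((phi << w >>)@_v * Li_index (exponents v) (mobius 1 u)).
    by move=> /supp Vv; apply: is_series_mull; apply/is_pseriesE; exact: (Li_indexP Vv).1.
  apply: is_series_ext (is_series_sum Ha) => n.
  rewrite -(phi_Li_coef n phi_x phi_y Vw) fmK mulr_suml.
  by apply: eq_bigr => v _; exact: mulrA.
(* The segment from 0 to [u] stays in a half-plane containing [u], hence in the slit plane. *)
- move=> u t Hu t01; apply: half_plane_slit.
  exact: half_plane_star (slit_half_plane Hu) t01.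
- move=> u Hu; apply: analytic_lincomb => v /supp Vv; apply: analytic_mobius.
    rewrite mul1r; apply/eqP => E; apply: Hu; rewrite E /=; lra.
  exact: (Li_indexP Vv).2 (slit_mobius1 Hu).
- exact: (Li_indexP Vw).2.
- lra.
Qed.
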